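(* Let $\mathbb K$ be a complete separable non-Archimedean valued field with nontrivial valuation. Any unilateral weighted backward shift $B_{\mathbf a}$ on $c_0(\mathbb N)$, with weight sequence $\mathbf a=(a_n)_{n\in\mathbb N}$, is supercyclic. Moreover, $B_{\mathbf a}$ is hypercyclic if and only if $$\limsup_{n\to\infty}\prod_{i=1}^n|a_i|=\infty.$$
   Context: A non-Archimedean valued field is a commutative field $\mathbb K$ with a map $|\cdot|:\mathbb K\to[0,+\infty)$ such that $|\lambda|=0$ iff $\lambda=0$, $|\lambda\mu|=|\lambda||\mu|$, and $|\lambda+\mu|\le\max\{|\lambda|,|\mu|\}$; the valuation is always assumed nontrivial. $\mathbb N=\{1,2,3,\dots\}$. $c_0(\mathbb N)=\{(x_n)_{n\in\mathbb N}: x_n\in\mathbb K,\ |x_n|\to 0\}$ with norm $\|\mathbf x\|=\sup_n|x_n|$, assumed to be a separable Banach space (equivalently, $\mathbb K$ is complete and separable). $\mathbf e_n$ is the vector whose $n$-th coordinate is $1$ and whose other coordinates are $0$. For a bounded sequence $\mathbf a=(a_n)_{n\in\mathbb N}$ of non-zero elements of $\mathbb K$, the unilateral weighted backward shift $B_{\mathbf a}$ is the continuous linear operator on $c_0(\mathbb N)$ with $B_{\mathbf a}(\mathbf e_1)=\mathbf 0$ and $B_{\mathbf a}(\mathbf e_n)=a_{n-1}\mathbf e_{n-1}$ for $n\ge 2$. A continuous linear operator $T$ on $X$ is hypercyclic if some orbit $\{T^n(\mathbf x): n\ge 0\}$, $\mathbf x\in X$, is dense in $X$, and supercyclic if some projective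 orbit $\{\lambda T^n(\mathbf x): n\ge 0,\ \lambda\in\mathbb K\}$, $\mathbf x\in X$, is dense in $X$. *)

(* Defs.v *)
From HB Require Import structures.
From mathcomp Require Import all_boot all_order all_algebra.
From mathcomp Require Import all_classical all_reals all_analysis.

Set Implicit Arguments.
Unset Strict Implicit.
Unset Printing Implicit Defensive.

Import Order.TTheory GRing.Theory Num.Theory.
Import numFieldNormedType.Exports.

Local Open Scope classical_set_scope.
Local Open Scope ring_scope.

(* The library's norms satisfy `|x *+ n| = `|x| *+ n, which no ultrametric
   absolute value does, hence a separate structure. *)
HB.mixin Record Field_isNAValued (R : realType) K & GRing.Field K := {
  absv : K -> R ;
  absv_ge0 : forall x : K, 0 <= absv x ;
  absv0P : forall x : K, absv x = 0 <-> x = 0 ;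
  absvM : forall x y : K, absv (x * y) = absv x * absv y ;
  absv_ultra : forall x y : K, absv (x + y) <= Num.max (absv x) (absv y)
}.

#[short(type="naValuedFieldType")]
HB.structure Definition NAValuedField (R : realType) :=
  { K of GRing.Field K & Field_isNAValued R K }.

Section valued_field_theory.
Context {R : realType} {K : naValuedFieldType R}.
Implicit Types x y : K.

Lemma absv0 : absv (0 : K) = 0 :> R. Proof. exact/absv0P. Qed.

Lemma absv1 : absv (1 : K) = 1 :> R.
Proof.
have h : absv (1 : K) * absv (1 : K) = absv (1 : K) :> R.
  by rewrite -absvM mulr1.
have n0 : absv (1 : K) != 0 :> R by apply/eqP => /absv0P/eqP; rewrite oner_eq0.
exact: (mulfI n0 (etrans h (esym (mulr1 _)))).
Qed.

Lemma absvN x : absv (- x) = absv x :> R.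
Proof.
suff h : absv (-1 : K) = 1 :> R by rewrite -mulN1r absvM h mul1r.
apply/eqP; rewrite -(@eqrXn2 _ 2)//; last exact: absv_ge0.
by rewrite expr2 -absvM mulrNN mulr1 absv1 expr1n.
Qed.

Lemma absvD_le x y : absv (x + y) <= absv x + absv y :> R.
Proof.
by rewrite (le_trans (absv_ultra _ _))// ge_max lerDl lerDr !absv_ge0.
Qed.

End valued_field_theory.

Definition nontrivial_valuation (R : realType) (K : naValuedFieldType R) :=
  exists x : K, x != 0 /\ absv x != 1 :> R.

Definition metric_complete (R : realType) (X : metricType R) :=
  forall u : nat -> X, cauchy (u n @[n --> \oo]) ->
  exists l : X, u n @[n --> \oo] --> l.

Definition metric_separable (R : realType) (X : metricType R) :=
  exists2 D : set X, countable D & dense D.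

(* K with the distance |x - y| *)
Definition valued_metric (R : realType) (K : naValuedFieldType R) : Type := K.

Section valued_metric_instance.
Context (R : realType) (K : naValuedFieldType R).

Let d (x y : valued_metric K) : R := absv ((x : K) - (y : K)).

Let d_xx x : d x x = 0. Proof. by rewrite /d subrr absv0. Qed.

Let d_pos x y : d x y = 0 -> x = y.
Proof. by move=> /absv0P/eqP; rewrite subr_eq0 => /eqP. Qed.

Let d_sym x y : d x y = d y x. Proof. by rewrite /d -absvN opprB. Qed.

Let d_triangle y x z : d x z <= d x y + d y z.
Proof. by rewrite /d -(subrKA (y : K)) absvD_le. Qed.

HB.instance Definition _ := Choice.copy (valued_metric K) K.
HB.instance Definition _ :=
  isMetric.Build R (valued_metric K) d_xx d_pos d_sym d_triangle.

End valued_metric_instance.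

Section c0_predicate.
Context (R : realType) (K : naValuedFieldType R).

Definition vanishing : {pred (nat -> K^o)} :=
  fun x => `[< absv (x n : K) @[n --> \oo] --> (0 : R) >].

Lemma vanishing_submod_closed : submod_closed vanishing.
Proof.
split=> [|a x y /asboolP x0 /asboolP y0].
  apply/asboolP; under eq_fun do rewrite absv0; exact: cvg_cst.
apply/asboolP.
apply: (@squeeze_cvgr _ _ _ _ (cst 0)
  (fun n => absv (a : K) * absv (x n : K) + absv (y n : K))).
- by apply: nearW => n; rewrite absv_ge0/= -absvM absvD_le.
- exact: cvg_cst.
- rewrite -[X in _ --> X]addr0 -[X in X + _](mulr0 (absv a)).
  by apply: cvgD => //; apply: cvgMr.
Qed.

HB.instance Definition _ :=
  GRing.isSubmodClosed.Build K (nat -> K^o) vanishing vanishing_submod_closed.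

End c0_predicate.

Record c0 (R : realType) (K : naValuedFieldType R) := C0 {
  c0_seq :> nat -> K^o ;
  c0_vanishing : c0_seq \in @vanishing R K
}.

Section c0_space.
Context (R : realType) (K : naValuedFieldType R).

HB.instance Definition _ := [isSub for @c0_seq R K].
HB.instance Definition _ := [Choice of c0 K by <:].
HB.instance Definition _ := [SubChoice_isSubLmodule of c0 K by <:].

Definition c0_norm (x : c0 K) : R := sup (range (fun n => absv (x n : K))).

Lemma c0_cvg (x : c0 K) : absv (x n : K) @[n --> \oo] --> (0 : R).
Proof. exact/asboolP/(c0_vanishing x). Qed.

Lemma c0_has_sup (x : c0 K) : has_sup (range (fun n => absv (x n : K) : R)).
Proof.
split; first by exists (absv (x 0%N : K)), 0%N.
have /cvg_seq_bounded [M [_ /(_ (M + 1))]] : cvgn (fun n => absv (x n : K) : R).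
  by apply/cvg_ex; exists 0; exact: c0_cvg.
rewrite ltrDl ltr01 => /(_ isT) hM.
exists (M + 1) => _ [n _ <-].
by rewrite (le_trans (ler_norm _))//; exact: hM.
Qed.

Lemma absv_le_c0_norm (x : c0 K) n : absv (x n : K) <= c0_norm x.
Proof. by apply: sup_ubound; [case: (c0_has_sup x)|exists n]. Qed.

Lemma c0_norm_le (x : c0 K) (M : R) :
  (forall n, absv (x n : K) <= M) -> c0_norm x <= M.
Proof.
move=> h; apply: ge_sup; first by case: (c0_has_sup x).
by move=> _ [n _ <-].
Qed.

Let d (x y : c0 K) : R := c0_norm (x - y).

Let d_xx x : d x x = 0.
Proof.
rewrite /d subrr; apply/eqP; rewrite eq_le; apply/andP; split.
  by apply: c0_norm_le => n; rewrite absv0.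
by rewrite (le_trans _ (absv_le_c0_norm _ 0))// absv_ge0.
Qed.

Let d_pos x y : d x y = 0 -> x = y.
Proof.
move=> h; apply: val_inj; apply/funext => n.
apply/eqP; rewrite -subr_eq0; apply/eqP.
suff /absv0P : absv ((x - y) n : K) = 0 :> R by [].
by apply/eqP; rewrite eq_le absv_ge0 andbT -h absv_le_c0_norm.
Qed.

Let d_sym x y : d x y = d y x.
Proof.
rewrite /d /c0_norm.
suff -> : (fun n => absv ((x - y) n : K)) =
  (fun n => absv ((y - x) n : K)) :> (nat -> R) by [].
by apply/funext => n; rewrite -absvN -(opprB x y).
Qed.

Let d_triangle y x z : d x z <= d x y + d y z.
Proof.
apply: c0_norm_le => n; rewrite -(subrKA y).
by rewrite (le_trans (absvD_le _ _))// lerD// absv_le_c0_norm.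
Qed.

HB.instance Definition _ := isMetric.Build R (c0 K) d_xx d_pos d_sym d_triangle.

Lemma c0_ballE (x : c0 K) (e : R) : ball x e = [set y | c0_norm (x - y) < e].
Proof. by []. Qed.

Lemma c0_unit_vanishing (n : nat) :
  ((fun k => (k == n)%:R) : nat -> K^o) \in @vanishing R K.
Proof.
apply/asboolP/cvgrPdist_lt => e e0; near=> k.
have -> : (k == n) = false by apply/gtn_eqF; near: k; exact: nbhs_infty_gt.
by rewrite absv0 subr0 normr0.
Unshelve. all: end_near. Qed.

Definition c0_unit (n : nat) : c0 K := C0 (c0_unit_vanishing n).

End c0_space.

Section dynamics.
Context (R : realType) (K : naValuedFieldType R).
Implicit Type T : c0 K -> c0 K.

Definition hypercyclic T :=
  exists x : c0 K, dense [set y | exists n : nat, y = iter n T x].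

Definition supercyclic T :=
  exists x : c0 K,
    dense [set y | exists (l : K) (n : nat), y = l *: iter n T x].

(* Indices start at 0: with sequences indexed by {1, 2, ...}, c0_unit n is
   the vector e_(n+1) and a n is the weight a_(n+1). *)
Definition weighted_backward_shift (a : nat -> K)
    (T : {linear c0 K -> c0 K}) :=
  [/\ continuous T,
      T (c0_unit K 0) = 0 &
      forall n, T (c0_unit K n.+1) = a n *: c0_unit K n].

Definition bounded_weights (a : nat -> K) :=
  exists M : R, forall n, absv (a n) <= M.

End dynamics.

Section shift_exists.
Context (R : realType) (K : naValuedFieldType R) (a : nat -> K) (M : R).
Hypothesis aM : forall n, absv (a n) <= M.

Let M0 : 0 <= M. Proof. exact: le_trans (absv_ge0 _) (aM 0). Qed.

Let shift_seq (x : nat -> K^o) : nat -> K^o := fun n => a n *: x n.+1.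

Let shift_vanishing (x : c0 K) : shift_seq x \in @vanishing R K.
Proof.
apply/asboolP; apply: (@squeeze_cvgr _ _ _ _ (cst 0)
  (fun n => M * absv (x n.+1 : K))).
- by apply: nearW => n; rewrite absv_ge0/= absvM ler_wpM2r ?absv_ge0.
- exact: cvg_cst.
- rewrite -(mulr0 M); apply: cvgMr.
  by have := @c0_cvg R K x; rewrite -(cvg_shiftS (fun n => absv (x n : K))).
Qed.

Let shift (x : c0 K) : c0 K := C0 (shift_vanishing x).

Let shift_linear : linear shift.
Proof.
move=> k x y; apply: val_inj; apply/funext => n /=.
rewrite /shift_seq /= /GRing.scale/= mulrDr.
by congr (_ + _); rewrite mulrCA.
Qed.

HB.instance Definition _ := GRing.isLinear.Build K (c0 K) (c0 K) *:%R shift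
  shift_linear.

Let shift_continuous : continuous shift.
Proof.
move=> x.
apply/(@cvg_ballP R (c0 K) (c0 K) (nbhs x) (nbhs_filter x) shift) => e e0.
have M1 : 0 < M + 1 by rewrite ltr_wpDl.
have : nbhs x (ball x (e / (M + 1))) by apply: nbhsx_ballx; rewrite divr_gt0.
apply: (@filterS _ _ (nbhs_filter x)) => y.
rewrite !c0_ballE/= ltr_pdivlMr// => xy; apply: le_lt_trans xy.
apply: c0_norm_le => n; rewrite -linearB/= absvM [leRHS]mulrC.
apply: ler_pM; rewrite ?absv_ge0//; last exact: absv_le_c0_norm (x - y) n.+1.
by rewrite (le_trans (aM n))// lerDl.
Qed.

Lemma weighted_backward_shift_exists :
  exists T : {linear c0 K -> c0 K}, weighted_backward_shift a T.
Proof.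
exists shift; split; first exact: shift_continuous.
- apply: val_inj; apply/funext => n /=; rewrite /shift_seq/=.
  by rewrite scaler0.
- move=> m; apply: val_inj; apply/funext => n /=; rewrite /shift_seq/= eqSS.
  rewrite -[RHS]/(a m *: ((n == m)%:R : K^o)).
  by have [->//|_] := eqVneq n m; rewrite !scaler0.
Qed.

End shift_exists.

(* Main.v *)
Require Import Defs.
From mathcomp Require Import all_boot all_order all_algebra.
From mathcomp Require Import all_classical all_reals all_analysis.
From mathcomp Require Import ring.

(** Write w(k, n) for the product of the n weights a_k, ..., a_(k+n-1). By
    continuity, B acts on every null sequence by (B x)_k = a_k x_(k+1), hence
    (B^n x)_k = w(k, n) x_(k+n): to know B^n x is to know x from index n on,
    up to explicit factors.

    For the existence of dense orbits, fix a sequence of finite lists of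
    scalars which is dense in c_0; it exists because K is separable. A list s
    has, for each n, a preimage under B^n supported on the indices n + k with
    k < size s, namely s_k / w(k, n) at n + k. Let L be a set of nonzero
    scalars such that every list, multiplied by some l in L, has arbitrarily
    small preimages of this kind with n as large as desired
    ([small_preimages]). Place such preimages of the successive lists in
    disjoint blocks of indices, each one so small that it does not
    spoil the approximations already achieved. The blocks form
    a null sequence x, and B^n x with n the start of a block is, up to a small
    error, the multiple by l of the corresponding list: earlier
    blocks are erased by B^n, later ones are negligible
    ([universal_sequence]). So the vectors l^-1 B^n x are dense. No sum of
    errors appears, because distinct blocks live on distinct coordinates and
    the norm is a supremum.

    With L the set of all nonzero scalars the condition always holds, the
    valuation being nontrivial: this is supercyclicity. With L = {1} it
    says that, for each m, the m numbers |w(k, n)| with k < m can be made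
    simultaneously large. Since |w(0, n + k)| = |w(0, k)| |w(k, n)| and the
    weights are bounded, one large value of |w(0, p)| forces the m preceding
    ones to be large as well, so that limsup |w(0, n)| = +oo is enough.

    Conversely, an orbit point B^n x that is closer to c e_0 than |c| has
    |w(0, n) x_n| >= |c| by the ultrametric inequality, whence
    |w(0, n)| >= |c| / ||x||, where |c| is arbitrary. *)

Set Implicit Arguments.
Unset Strict Implicit.
Unset Printing Implicit Defensive.

Import Order.TTheory GRing.Theory Num.Theory.
Import numFieldNormedType.Exports.

Local Open Scope classical_set_scope.
Local Open Scope ring_scope.

(** * Absolute values *)

Section absolute_value.
Context {R : realType} {K : naValuedFieldType R}.
Implicit Types x y : K.

Lemma absv_eq0 x : (absv x == 0 :> R) = (x == 0).
Proof. by apply/eqP/eqP => /absv0P. Qed.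

Lemma absv_gt0 x : (0 < absv x :> R) = (x != 0).
Proof. by rewrite lt_neqAle absv_ge0 andbT eq_sym absv_eq0. Qed.

Lemma absvV x : absv x^-1 = (absv x)^-1 :> R.
Proof.
have [->|x0] := eqVneq x 0; first by rewrite invr0 absv0 invr0.
apply: (@mulfI _ (absv x)); first by rewrite absv_eq0.
by rewrite -absvM !divff ?absv_eq0// absv1.
Qed.

Lemma absvX x n : absv (x ^+ n) = absv x ^+ n :> R.
Proof.
elim: n => [|n ih]; first by rewrite !expr0 absv1.
by rewrite !exprS absvM ih.
Qed.

Lemma absv_prod n (f : nat -> K) :
  absv (\prod_(i < n) f i) = \prod_(i < n) absv (f i) :> R.
Proof. by rewrite (big_morph _ (@absvM _ _) absv1). Qed.

Lemma absvB_le_max x y (c : R) :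
  absv x <= c -> absv y <= c -> absv (x - y) <= c.
Proof.
by move=> xc yc; rewrite (le_trans (absv_ultra _ _))// ge_max absvN xc yc.
Qed.

Lemma absv_sum_le n (f : nat -> K) (c : R) : 0 <= c ->
  (forall i, absv (f i) <= c) -> absv (\sum_(i < n) f i) <= c.
Proof.
move=> c0 fc; apply: (big_ind (fun x : K => absv x <= c)) => //.
  by rewrite absv0.
by move=> x y xc yc; rewrite (le_trans (absv_ultra _ _))// ge_max xc yc.
Qed.

Lemma small_absv (e : R) : nontrivial_valuation K -> 0 < e ->
  exists2 x : K, x != 0 & absv x <= e.
Proof.
move=> [y [y0 y1]] e0.
have [z z0 z1] : exists2 z : K, z != 0 & absv z < 1 :> R.
  have [y_lt1|y_ge1] := ltP (absv y : R) 1; first by exists y.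
  exists y^-1; rewrite ?invr_eq0//.
  by rewrite absvV invf_lt1 ?absv_gt0// lt_neqAle eq_sym y1.
have /cvgrPdist_le/(_ e e0) : (absv z : R) ^+ n @[n --> \oo] --> (0 : R).
  by apply: cvg_expr; rewrite ger0_norm ?absv_ge0.
move=> [n _ /(_ n (leqnn n))]; rewrite /= sub0r normrN -absvX.
by rewrite ger0_norm ?absv_ge0// => zn; exists (z ^+ n); rewrite ?expf_neq0.
Qed.

End absolute_value.

(** * The space of null sequences *)

Section null_sequences.
Context {R : realType} {K : naValuedFieldType R}.
Implicit Types (x y : c0 K) (e : R).

Lemma c0_tail_small x e : 0 < e ->
  exists m, forall k, (m <= k)%N -> absv (x k : K) <= e.
Proof.
move=> e0; have /cvgrPdist_le/(_ e e0)[m _ xm] := c0_cvg x.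
by exists m => k /xm /=; rewrite sub0r normrN ger0_norm ?absv_ge0.
Qed.

(** Approximation coordinate by coordinate, uniformly, is approximation in
    norm; this spares the later proofs any computation of norms. *)
Lemma c0_dense_approx (S : set (c0 K)) :
  (forall x e, 0 < e -> exists2 y, S y & forall k, absv ((x k : K) - y k) <= e) ->
  dense S.
Proof.
move=> approx O [x Ox] openO.
have /nbhs_ballP[e /= e0 xeO] : nbhs x O by exact: open_nbhs_nbhs.
have [y Sy xy] := approx x (e / 2) (divr_gt0 e0 (ltr0Sn R 1)).
exists y; split=> //; apply: xeO; rewrite c0_ballE/=.
apply: (@le_lt_trans _ _ (e / 2)); first exact: c0_norm_le.
by rewrite ltr_pdivrMr// ltr_pMr// ltr1n.
Qed.

Definition c0_trunc x (m : nat) : c0 K := \sum_(k < m) (x k : K) *: c0_unit K k.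

Lemma c0_truncE x m n : c0_trunc x m n = if (n < m)%N then x n else 0.
Proof.
elim: m => [|m ih]; first by rewrite /c0_trunc big_ord0.
rewrite /c0_trunc big_ord_recr/= -/(c0_trunc x m).
transitivity ((c0_trunc x m n : K) + x m * (n == m)%:R) => //.
rewrite ih ltnS [in RHS]leq_eqVlt; case: eqVneq => [->|_] /=.
  by rewrite ltnn add0r mulr1.
by rewrite mulr0 addr0.
Qed.

End null_sequences.

(** * Coordinates of the shift and of its powers *)

Section shift.
Context {R : realType} {K : naValuedFieldType R} (a : nat -> K).

(** Both sides are additive in x, agree on truncations by linearity and the
    values on unit vectors, and depend continuously on x. *)
Lemma shift_coord (B : {linear c0 K -> c0 K}) : weighted_backward_shift a B ->
  forall (x : c0 K) n, B x n = a n * x n.+1.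
Proof.
move=> [Bcont B0 BS] x n.
have BT m : B (c0_trunc x m) n = a n * (c0_trunc x m n.+1 : K).
  rewrite /c0_trunc; elim: m => [|m ih].
    by rewrite !big_ord0 linear0 [RHS]mulr0.
  rewrite !big_ord_recr/= linearD linearZ/=.
  transitivity ((B (c0_trunc x m) n : K) + x m * (B (c0_unit K m) n : K)) => //.
  rewrite {}ih -[RHS]/(a n * ((c0_trunc x m n.+1 : K) + x m * (n.+1 == m)%:R)).
  rewrite mulrDr mulrCA; congr (_ + _ * _).
  case: m => [|m]; first by rewrite B0 mulr0.
  rewrite BS -[LHS]/(a m * (n == m)%:R) eqSS.
  by case: eqVneq => [->//|_]; rewrite !mulr0.
apply/eqP; rewrite -subr_eq0 -(@absv_eq0 R); apply/negP => /negP d0.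
(* The error e is at most |(B z)_n| for z a tail of x, which continuity makes
   smaller than e. *)
set e : R := absv _ in d0; have e0 : 0 < e.
  by rewrite lt_neqAle eq_sym d0 absv_ge0.
have [r /= r0 Br] : nbhs_ball (0 : c0 K) (B @^-1` ball (B 0) e).
  by apply/nbhs_ballP; apply: Bcont; exact: nbhsx_ballx.
have [m xm] := c0_tail_small x (divr_gt0 r0 (ltr0Sn R 1)).
(* Truncating beyond n + 1 makes x and its truncation agree at that index. *)
pose z := x - c0_trunc x (maxn m n.+2).
have zE k : (z k : K) = if (k < maxn m n.+2)%N then 0 else x k.
  rewrite -[LHS]/((x k : K) - c0_trunc x _ k) c0_truncE.
  by case: ifP; rewrite ?subrr ?subr0.
have : ball (B 0) e (B (- z)).
  apply: Br; rewrite c0_ballE; suff : c0_norm (0 - - z) < r by [].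
  rewrite sub0r opprK.
  apply: (@le_lt_trans _ _ (r / 2)); last first.
    by rewrite ltr_pdivrMr// ltr_pMr// ltr1n.
  apply: c0_norm_le => k; rewrite zE; case: ltnP => [_|].
    by rewrite absv0 ltW// divr_gt0.
  by rewrite geq_max => /andP[/xm].
rewrite c0_ballE linear0 linearN.
rewrite -[X in X -> _]/(is_true (c0_norm (0 - - B z) < e)) sub0r opprK => zlt.
have := le_lt_trans (absv_le_c0_norm (B z) n) zlt.
rewrite linearB/= -[(_ - _) n]/((B x n : K) - B (c0_trunc x _) n) BT c0_truncE.
by rewrite leq_max ltnSn orbT ltxx.
Qed.

Definition weight_prod k n : K := \prod_(i < n) a (k + i)%N.

Lemma weight_prodS k n : weight_prod k n.+1 = a k * weight_prod k.+1 n.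
Proof.
rewrite /weight_prod big_ord_recl/= addn0; congr (_ * _).
by apply: eq_bigr => i _; rewrite addSnnS.
Qed.

Lemma weight_prod_cat k n :
  weight_prod 0 (k + n) = weight_prod 0 k * weight_prod k n.
Proof. by rewrite /weight_prod big_split_ord. Qed.

Lemma iter_shift_coord (B : {linear c0 K -> c0 K}) :
  weighted_backward_shift a B -> forall n (x : c0 K) k, iter n B x k = weight_prod k n * (x (k + n)%N : K).
Proof.
move=> Ba n x; elim: n => [|n ih] k.
  by rewrite /weight_prod big_ord0 mul1r addn0.
by rewrite iterS (shift_coord Ba) ih weight_prodS mulrA addSnnS.
Qed.

Lemma weight_prod_neq0 : (forall n, a n != 0) -> forall k n, weight_prod k n != 0.
Proof. by move=> a0 k n; apply/prodf_neq0 => i _. Qed.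

Lemma weight_prod_le (M : R) : (forall n, absv (a n) <= M) ->
  forall k n, absv (weight_prod k n) <= M ^+ n.
Proof.
move=> aM k n; rewrite (absv_prod n (fun i => a (k + i)%N)).
rewrite -[n in leRHS]card_ord -prodr_const.
by apply: ler_prod => i _; rewrite absv_ge0 aM.
Qed.

End shift.

(** * Infinite upper limits *)

Section limsup.
Context {R : realType}.
Implicit Types u : nat -> R.

Lemma limn_esup_inf (u : (\bar R)^nat) : limn_esup u = ereal_inf (range (esups u)).
Proof. by rewrite limn_esup_lim; apply: cvg_lim => //; exact: cvg_esups_inf. Qed.

Lemma limn_esup_pinfty_gt u : limn_esup (fun n => (u n)%:E) = +oo%E :> \bar R ->
  forall C N, exists2 n, (N <= n)%N & C < u n.
Proof.
rewrite limn_esup_inf => uoo C N.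
have : (C%:E < esups (fun n => (u n)%:E) N)%E.
  apply: (@lt_le_trans _ _ +oo%E); first by rewrite ltry.
  by rewrite -uoo; apply: ereal_inf_lbound; exists N.
by move=> /ereal_sup_gt[_ [n /= Nn <-]]; rewrite lte_fin; exists n.
Qed.

(** Unboundedness alone suffices: finitely many terms are bounded, so large
    values occur arbitrarily far. *)
Lemma limn_esup_pinfty u : (forall n, 0 <= u n) ->
  (forall C, exists n, C < u n) ->
  limn_esup (fun n => (u n)%:E) = +oo%E :> \bar R.
Proof.
move=> u0 unb; rewrite limn_esup_inf.
apply/eqP; rewrite -leye_eq; apply: le_ereal_inf_tmp => _ [N _ <-].
rewrite leye_eq; apply/eqP/eqyP => C C0.
(* Adding the first N terms to C forces n to lie beyond N. *)
have [n] := unb (C + \sum_(i < N) u i); have [nN|Nn un] := ltnP n N.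
  rewrite (bigD1 (Ordinal nN))//= addrCA gtrDl ltNge addr_ge0 ?sumr_ge0//.
  exact: ltW.
apply: (@le_trans _ _ (u n)%:E).
  by rewrite lee_fin (le_trans _ (ltW un))// lerDl sumr_ge0.
by apply: ereal_sup_ubound; exists n.
Qed.
End limsup.

(** * A dense sequence of finite lists *)

Lemma dense_ball (R : realType) (X : metricType R) (D : set X) : dense D ->
  forall c (e : R), 0 < e -> exists2 y, D y & ball c e y.
Proof.
move=> dD c e e0; have [||y [cy Dy]] := dD (ball c e)^°.
- exists c; exact: (nbhsx_ballx c).
- exact: open_interior.
- by exists y => //; exact: interior_subset cy.
Qed.

Section dense_lists.
Context {R : realType} {K : naValuedFieldType R}.

Lemma dense_sequence : metric_separable (valued_metric K) ->
  exists d : nat -> K, forall (c : K) (e : R), 0 < e ->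
  exists i, absv (c - d i) < e.
Proof.
move=> [D cD dD].
have near_D (c : K) (e : R) : 0 < e -> exists2 y : K, D y & absv (c - y) < e.
  exact: (@dense_ball _ (valued_metric K)).
have /pfcard_geP[D0|[f]] := cD.
  by have [y] := near_D 0 1 ltr01; rewrite D0.
exists f => c e /(near_D c)[y /(@surj _ _ _ _ f)[i _ <-]]; by exists i.
Qed.

(** The list t_j stands for the finitely supported vector with these first
    coordinates. Each list comes with a tolerance e_j, so that one index j
    delivers both a list close to x and a tolerance below r; no list has to be
    repeated infinitely often in an explicit way. *)
Lemma dense_lists : metric_separable (valued_metric K) ->
  exists (t : nat -> seq K) (e : nat -> R), (forall j, 0 < e j) /\
  forall (x : c0 K) r, 0 < r ->
  exists2 j, e j < r & forall k, absv ((x k : K) - nth 0 (t j) k) <= r.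
Proof.
move=> /dense_sequence[d dP].
(* j codes a pair made of a list of indices into d and of a number q, the
   tolerance being 1 / (q + 1). *)
pose p (j : nat) : seq nat * nat := odflt ([::] : seq nat, 0%N) (unpickle j).
exists (fun j => map d (p j).1), (fun j => (p j).2.+1%:R^-1).
split=> [j|x r r0]; first by rewrite invr_gt0 ltr0Sn.
have [m xm] := c0_tail_small x r0.
have [i iP] := choice (fun k => dP (x k) r r0).
have [q _ /(_ q (leqnn q))/= qr] := near_infty_natSinv_lt (PosNum r0).
exists (pickle (mkseq i m, q)); rewrite /p pickleK//= => k.
have [km|mk] := ltnP k m.
  by rewrite (nth_map 0%N) ?size_mkseq// nth_mkseq// ltW.
by rewrite nth_default ?size_map ?size_iota// subr0 xm.
Qed.

End dense_lists.

(** * A vector whose orbit approximates a sequence of lists *)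

Section universal.
Context {R : realType} {K : naValuedFieldType R} (a : nat -> K) (M : R).
Hypotheses (a0 : forall n, a n != 0) (M0 : 0 < M)
  (aM : forall n, absv (a n) <= M).

(** The numbers bounded by e are the coordinates, from index n on, of the
    preimage of l s under the n-th power of the shift that vanishes before index n. *)
Definition small_preimages (L : set K) := forall (s : seq K) (e : R) N, 0 < e ->
  exists n l, [/\ (N <= n)%N, L l &
    forall k, absv (l * nth 0 s k / weight_prod a k n) <= e].

(** The blocks are chosen one after the other. The state (N, r) before step j
    records where the free indices start and how small everything placed from
    now on has to be. Step j chooses n >= N and l, and places at n the preimage
    of l t_j. The next N lies behind that block; the next r is also at most
    |l| e_j / M^n, so that n shifts, which enlarge by at most M^n, leave
    later blocks below |l| e_j, and at most 1 / (j + 1), so that x tends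
    to zero. *)
Lemma universal_sequence (L : set K) (t : nat -> seq K) (e : nat -> R) :
  (forall l, L l -> l != 0) -> small_preimages L -> (forall j, 0 < e j) ->
  exists x : c0 K, forall j, exists n l, L l /\
    forall k, absv (weight_prod a k n * x (k + n)%N - l * nth 0 (t j) k)
              <= absv l * e j.
Proof.
move=> L0 small e0.
have /choice[f fP] : forall p : nat * (nat * R), exists q : nat * K, 0 < p.2.2 ->
    [/\ (p.2.1 <= q.1)%N, L q.2 & forall k,
     absv (q.2 * nth 0 (t p.1) k / weight_prod a k q.1) <= p.2.2].
  move=> [j [N r]]/=; have [r0|_] := ltP 0 r; last by exists (0%N, 0).
  by have [n [l H]] := small (t j) r N r0; exists (n, l).
(* The successor makes N strictly increasing even when a list is empty, so
   that j <= N j. *)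
pose next j (s : nat * R) : nat * R :=
  let q := f (j, s) in
  ((q.1 + size (t j)).+1,
   Num.min s.2 (Num.min j.+1%:R^-1 (absv q.2 * e j / M ^+ q.1))).
pose fix st j := if j is i.+1 then next i (st i) else (0%N, 1 : R).
pose N j := (st j).1; pose r j := (st j).2.
pose n j := (f (j, st j)).1; pose l j := (f (j, st j)).2.
have NS j : N j.+1 = (n j + size (t j)).+1 by [].
have rS j : r j.+1 =
  Num.min (r j) (Num.min j.+1%:R^-1 (absv (l j) * e j / M ^+ n j)) by [].
have r0 j : 0 < r j.
  elim: j => [|j rj]; first exact: ltr01.
  have [_ lj _] := fP (j, st j) rj.
  rewrite rS !lt_min rj invr_gt0 ltr0Sn/= divr_gt0 ?exprn_gt0// mulr_gt0//.
  by rewrite absv_gt0 L0.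
have Nn j : (N j <= n j)%N by have [] := fP (j, st j) (r0 j).
have Ll j : L (l j) by have [] := fP (j, st j) (r0 j).
pose b j k := l j * nth 0 (t j) k / weight_prod a k (n j).
have br j k : absv (b j k) <= r j by have [_ _] := fP (j, st j) (r0 j); apply.
have NSle j : (N j < N j.+1)%N by rewrite NS ltnS (leq_trans (Nn j)) ?leq_addr.
have Nmono i j : (i <= j)%N -> (N i <= N j)%N.
  by apply: (@homo_leq _ N leq leqnn leq_trans) => k; exact/ltnW.
have rmono i j : (i <= j)%N -> r j <= r i.
  apply: (@homo_leq _ r (fun x y => y <= x)) => //.
    by move=> x y z /[swap]; exact: le_trans.
  by move=> k; rewrite rS ge_min lexx.
have Nge j : (j <= N j)%N.
  by elim: j => // j ij; exact: leq_ltn_trans ij (NSle j).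
pose z j p : K := if (n j <= p)%N then b j (p - n j)%N else 0.
have z_before j p : (p < N j)%N -> z j p = 0.
  by move=> pj; rewrite /z leqNgt (leq_trans pj (Nn j)).
have z_after j p : (N j.+1 <= p)%N -> z j p = 0.
  rewrite NS /z => pj; have np : (n j <= p)%N.
    by rewrite (leq_trans _ (ltnW pj))// leq_addr.
  rewrite np /b nth_default ?mulr0 ?mul0r//.
  by rewrite leq_subRL// ltnW.
have zr j p : absv (z j p) <= r j.
  by rewrite /z; case: ifP => // _; rewrite absv0 ltW.
(* Block j starts at an index >= j, so the blocks up to p are all that can
   contribute at p, and at most one of them does. *)
pose x p : K^o := \sum_(j < p.+1) z j p.
have x_tail j p : (N j <= p)%N -> absv (x p : K) <= r j.
  move=> jp; apply: (@absv_sum_le _ _ p.+1 (z^~ p)) => [|i]; first exact: ltW.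
  have [ij|ji] := ltnP i j; last exact: le_trans (zr _ _) (rmono _ _ ji).
  by rewrite z_after ?absv0 1?ltW// (leq_trans _ jp)// Nmono.
have x_block j p : (N j <= p < N j.+1)%N -> x p = z j p.
  move=> /andP[jp pj]; rewrite /x.
  have jp1 : (j < p.+1)%N by rewrite ltnS (leq_trans (Nge j)).
  rewrite (bigD1 (Ordinal jp1))//= big1 ?addr0// => -[i ip]/=.
  rewrite -val_eqE/= neq_ltn => /orP[ij|ji].
    by apply: z_after; rewrite (leq_trans _ jp)// Nmono.
  by apply: z_before; rewrite (leq_trans pj)// Nmono.
have x0 : x \in @vanishing R K.
  apply/asboolP/cvgrPdist_lt => d d0.
  have [m _ /(_ m (leqnn m))/= md] := near_infty_natSinv_lt (PosNum d0).
  exists (N m.+1) => // p /= mp.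
  rewrite sub0r normrN ger0_norm ?absv_ge0//.
  by rewrite (le_lt_trans (x_tail _ _ mp))// (le_lt_trans _ md)// rS
     !ge_min lexx orbT.
exists (C0 x0) => j; exists (n j), (l j); split=> // k /=.
have le0 : 0 <= absv (l j) * e j by rewrite mulr_ge0 ?absv_ge0// ltW.
(* Inside block j the value is exact; behind it the list has ended and only
   later blocks remain. *)
have [kj|jk] := ltnP (k + n j) (N j.+1).
  rewrite (x_block j) ?kj ?andbT; last by rewrite (leq_trans (Nn j)) ?leq_addl.
  rewrite /z leq_addl addnK /b mulrCA divff ?weight_prod_neq0// mulr1.
  by rewrite subrr absv0.
rewrite nth_default ?mulr0 ?subr0; last first.
  by move: jk; rewrite NS (addnC k) => /ltnW; rewrite leq_add2l.
rewrite absvM (@le_trans _ _ (M ^+ n j * r j.+1))//.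
  by rewrite ler_pM ?absv_ge0// ?weight_prod_le// x_tail.
by rewrite mulrC -ler_pdivlMr ?exprn_gt0// rS !ge_min lexx !orbT.
Qed.

Lemma dense_scaled_orbit (B : {linear c0 K -> c0 K}) (L : set K) :
  weighted_backward_shift a B -> metric_separable (valued_metric K) ->
  (forall l, L l -> l != 0) -> small_preimages L ->
  exists x : c0 K, dense [set y | exists l n, L l /\ y = l^-1 *: iter n B x].
Proof.
move=> Ba sepK L0 small.
have [t [e [e0 te]]] := dense_lists sepK.
have [x xP] := universal_sequence t L0 small e0.
exists x; apply: c0_dense_approx => y r r0.
have [j ejr yj] := te y r r0; have [n [l [Ll xl]]] := xP j.
exists (l^-1 *: iter n B x); first by exists l, n.
move=> k; have l0 := L0 l Ll.
have -> : (l^-1 *: iter n B x) k = l^-1 * (iter n B x k : K) :> K by [].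
rewrite (iter_shift_coord Ba).
set c : K := nth 0 (t j) k; set w : K := _ * x _.
have -> : (y k : K) - l^-1 * w = (y k - c) - (l^-1 * w - c).
  by rewrite opprB addrA subrK.
apply: absvB_le_max; first exact: yj.
rewrite -(mulKf l0 c) -mulrBr absvM absvV ler_pdivrMl ?absv_gt0//.
by rewrite (le_trans (xl k))// ler_wpM2l ?absv_ge0// ltW.
Qed.

End universal.

(** * The two growth conditions, and necessity *)

Section preimages.
Context {R : realType} {K : naValuedFieldType R} (a : nat -> K).
Hypothesis a0 : forall n, a n != 0.

Lemma absv_weight_prod0 n :
  absv (weight_prod a 0 n) = \prod_(i < n) absv (a i) :> R.
Proof. exact: absv_prod. Qed.

(** A fixed n will do: a small enough scalar l shrinks any finite list of
    numbers. *)
Lemma small_preimages_scaled :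
  nontrivial_valuation K -> small_preimages a [set l | l != 0].
Proof.
move=> ntK s e N e0;
pose D : R := 1 + \sum_(k < size s) absv (s`_k / weight_prod a k N).
have D0 : 0 < D by rewrite ltr_pwDl// sumr_ge0// => k _; exact: absv_ge0.
have [l l0 le] := small_absv ntK (divr_gt0 e0 D0).
exists N, l; split=> // k; have [ks|sk] := ltnP k (size s); last first.
  by rewrite nth_default// mulr0 mul0r absv0 ltW.
rewrite -mulrA absvM; move: le; rewrite ler_pdivlMr//; apply: le_trans.
rewrite ler_wpM2l ?absv_ge0// /D (bigD1 (Ordinal ks))//= addrCA lerDl.
by rewrite addr_ge0// sumr_ge0// => i _; exact: absv_ge0.
Qed.

(** With m the size of s and |w(0, p + 1)| large, take n = p + 1 - m. For k < m
    the index n + k is at most m short of p + 1, so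
    1 / |w(k, n)| = |w(0, k)| |w(k + n, m - k)| / |w(0, p + 1)|
    is at most |w(0, k)| M^m / |w(0, p + 1)|. *)
Lemma small_preimages_unscaled (M : R) : 1 <= M -> (forall n, absv (a n) <= M) ->
  (forall C N, exists2 n, (N <= n)%N & C < \prod_(i < n.+1) absv (a i)) ->
  small_preimages a [set 1].
Proof.
move=> M1 aM large s e N e0; set m := size s.
have M0 : 0 < M by exact: lt_le_trans M1.
pose D : R := 1 + \sum_(k < m) absv (s`_k * weight_prod a 0 k).
have [p Np Wp] := large (D * M ^+ m / e) (N + m)%N.
have mp : (m <= p.+1)%N by rewrite (leq_trans _ (leqW Np))// leq_addl.
exists (p.+1 - m)%N, 1; split=> // [|k].
  by rewrite leq_subRL// addnC (leq_trans Np).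
set n := (p.+1 - m)%N; have [km|mk] := ltnP k m; last first.
  by rewrite nth_default// mulr0 mul0r absv0 ltW.
have Wfactor : weight_prod a 0 p.+1 =
    weight_prod a 0 k * weight_prod a k n * weight_prod a (k + n) (m - k).
  rewrite -!weight_prod_cat; congr (weight_prod a 0 _).
  by rewrite addnAC subnKC ?subnKC// ltnW.
have W0 i j : weight_prod a i j != 0 by exact: weight_prod_neq0.
have -> : 1 * s`_k / weight_prod a k n =
    s`_k * weight_prod a 0 k * weight_prod a (k + n) (m - k) / weight_prod a 0 p.+1.
  by rewrite Wfactor; field; rewrite !W0.
rewrite absvM absvV ler_pdivrMr ?absv_gt0// absvM absv_weight_prod0.
move: Wp; rewrite ltr_pdivrMr// => /ltW; rewrite [leRHS]mulrC; apply: le_trans.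
apply: ler_pM; rewrite ?absv_ge0//.
  rewrite /D (bigD1 (Ordinal km))//= addrCA lerDl.
  by rewrite addr_ge0// sumr_ge0// => i _; exact: absv_ge0.
by rewrite (le_trans (weight_prod_le aM _ _))// ler_weXn2l// leq_subr.
Qed.

(** An orbit point in the ball of radius |c| around c e_0 has a coordinate 0 of
    absolute value at least |c|, while this coordinate is w(0, n) x_n. *)
Lemma hypercyclic_unbounded (B : {linear c0 K -> c0 K}) :
  nontrivial_valuation K -> weighted_backward_shift a B -> hypercyclic B ->
  forall C : R, exists n, C < \prod_(i < n.+1) absv (a i).
Proof.
move=> ntK Ba [x dx] C; pose X : R := c0_norm x + 1.
have X0 : 0 < X by rewrite ltr_wpDl// (le_trans _ (absv_le_c0_norm x 0))// absv_ge0.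
(* The summand 2 makes the bound on |w(0, n)| exceed w(0, 0) = 1, which
   excludes n = 0. *)
pose D : R := X * (`|C| + 2).
have D0 : 0 < D by rewrite mulr_gt0// ltr_wpDl.
have [d d_neq0 dD] : exists2 d : K, d != 0 & absv d <= D^-1.
  by apply: small_absv; rewrite ?invr_gt0.
pose c := d^-1.
have c0 : 0 < absv c :> R by rewrite absv_gt0 invr_eq0.
have Dc : D <= absv c by rewrite absvV -(invrK D) lef_pV2 ?posrE ?invr_gt0// absv_gt0.
have [y [n ->] cB] := dense_ball dx (c *: c0_unit K 0) c0.
have {cB} : absv (c - weight_prod a 0 n * x n) < absv c :> R.
  move: cB; rewrite c0_ballE; apply: le_lt_trans.
  have := absv_le_c0_norm (c *: c0_unit K 0 - iter n B x) 0.
  congr (absv _ <= _).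
  rewrite -[LHS]/(c * (0 == 0)%:R - (iter n B x 0 : K)) mulr1.
  by rewrite (iter_shift_coord Ba) add0n.
set w : K := _ * _ => cw.
have {cw} cw : absv c <= absv w :> R.
  rewrite leNgt; apply/negP => wc; have := absv_ultra (c - w) w.
  by rewrite subrK leNgt gt_max cw wc.
have : `|C| + 2 <= absv (weight_prod a 0 n) :> R.
  rewrite -(ler_pM2l X0) -/D (le_trans Dc)// (le_trans cw)// absvM mulrC.
  by rewrite ler_wpM2r ?absv_ge0// (le_trans (absv_le_c0_norm x n))// lerDl.
rewrite absv_weight_prod0; case: n {w cw} => [|n] CW.
  move: CW; rewrite big_ord0 => /(le_trans _).
  have := normr_ge0 C => C0 /(_ 2); rewrite lerDr => /(_ C0).
  by rewrite lern1.
exists n; rewrite (lt_le_trans _ CW)// (le_lt_trans (ler_norm C))// ltrDl.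
by rewrite ltr0n.
Qed.

End preimages.

Theorem theorem4p6 (R : realType) (K : naValuedFieldType R)
    (Kcomplete : metric_complete (valued_metric K))
    (Kseparable : metric_separable (valued_metric K))
    (Knontrivial : nontrivial_valuation K)
    (a : nat -> K)
    (a_neq0 : forall n, a n != 0)
    (a_bounded : bounded_weights a)
    (B : {linear c0 K -> c0 K})
    (B_shift : weighted_backward_shift a B) :
  supercyclic B /\
  (hypercyclic B <->
   limn_esup (fun n => (\prod_(i < n.+1) absv (a i))%:E) = +oo%E :> \bar R).
Proof.
have [M0 aM0] := a_bounded; pose M := Num.max 1 M0.
have M1 : 1 <= M by rewrite le_max lexx.
have M_gt0 : 0 < M by exact: lt_le_trans M1.
have aM n : absv (a n) <= M by rewrite le_max aM0 orbT.
split; last split.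
- have [//|x dx] := dense_scaled_orbit a_neq0 M_gt0 aM B_shift Kseparable _
    (small_preimages_scaled a Knontrivial).
  exists x => O O0 oO; have [y [Oy [l [n [_ yE]]]]] := dx O O0 oO.
  by exists y; split => //; exists l^-1, n.
- move=> hB; apply: limn_esup_pinfty.
    by move=> n; apply: prodr_ge0 => i _; exact: absv_ge0.
  exact: hypercyclic_unbounded hB.
- move=> /limn_esup_pinfty_gt large.
  have [l ->|x dx] := dense_scaled_orbit a_neq0 M_gt0 aM B_shift Kseparable _
    (small_preimages_unscaled a_neq0 M1 aM large); first exact: oner_neq0.
  exists x => O O0 oO; have [y [Oy [l [n [-> yE]]]]] := dx O O0 oO.
  by exists y; split => //; exists n; rewrite yE invr1 scale1r.
Qed.
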